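(* Let $\mathbb{K}$ be a field of characteristic zero and let $\mathcal{S}_2$ be the algebra of all commutative $2$-dimensional algebras with trace zero multiplication over $\mathbb{K}$. A map $\delta:\mathcal{S}_2\times\mathcal{S}_2\to\mathcal{S}_2$ is a biderivation of $\mathcal{S}_2$ if and only if $\delta$ is the zero mapping; that is, the space $\mathrm{BDer}(\mathcal{S}_2)$ of all biderivations of $\mathcal{S}_2$ is $\{0\}$.
   Context: Algebras are vector spaces over $\mathbb{K}$ with a bilinear multiplication; they need not be associative, commutative or unital. The algebra $\mathcal{S}_2$ is the $4$-dimensional algebra over $\mathbb{K}$ with basis $z_1,z_2,z_3,z_4$ and the following multiplication (left factor first; all products of basis elements not listed are $0$): $z_1z_1=-z_1$, $z_1z_2=z_2$, $z_1z_3=3z_3$, $z_1z_4=-3z_4$; $z_2z_1=-2z_2$, $z_2z_2=-3z_3$, $z_2z_4=z_1$; $z_4z_1=3z_4$, $z_4z_2=-2z_1$, $z_4z_3=-z_2$. A bilinear map $\delta:\mathcal{A}\times\mathcal{A}\to\mathcal{A}$ on an algebra $\mathcal{A}$ is a biderivation if $\delta(xy,z)=x\,\delta(y,z)+\delta(x,z)\,y$ and $\delta(x,yz)=y\,\delta(x,z)+\delta(x,y)\,z$ for all $x,y,z\in\mathcal{A}$. *)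

(* Defs.v *)
From HB Require Import structures.
From mathcomp Require Import all_boot all_order all_algebra.
From mathcomp Require Import boolp classical_sets.

Set Implicit Arguments.
Unset Strict Implicit.
Unset Printing Implicit Defensive.

Import GRing.Theory.
Local Open Scope classical_set_scope.
Local Open Scope ring_scope.

(* An algebra (not necessarily associative, commutative or unital) is an
   lmodType V together with a bilinear map mul : {bilinear V -> V -> V}. *)

Section Biderivations.
Variables (K : fieldType) (V : lmodType K) (mul : {bilinear V -> V -> V}).

Definition is_biderivation (delta : V -> V -> V) : Prop :=
  [/\ bilinear_for *:%R *:%R delta,
      forall x y z : V,
        delta (mul x y) z = mul x (delta y z) + mul (delta x z) y
    & forall x y z : V,
        delta x (mul y z) = mul y (delta x z) + mul (delta x y) z].

Definition BDer : set (V -> V -> V) := [set delta | is_biderivation delta].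

End Biderivations.

Notation S2 K := 'rV[K]_4.

Section AlgebraS2.
Variable K : fieldType.

(* Basis vectors are numbered from 1: the basis is z 1, z 2, z 3, z 4. *)
Definition z (i : nat) : S2 K := \row_(j < 4) (j.+1 == i)%:R.

Definition S2_table (i j : nat) : S2 K :=
  match i, j with
  | 1%N, 1%N => - z 1
  | 1%N, 2%N => z 2
  | 1%N, 3%N => 3%:R *: z 3
  | 1%N, 4%N => - (3%:R *: z 4)
  | 2%N, 1%N => - (2%:R *: z 2)
  | 2%N, 2%N => - (3%:R *: z 3)
  | 2%N, 4%N => z 1
  | 4%N, 1%N => 3%:R *: z 4
  | 4%N, 2%N => - (2%:R *: z 1)
  | 4%N, 3%N => - z 2
  | _, _ => 0
  end.

Definition S2_mul (x y : S2 K) : S2 K :=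
  \sum_(i < 4) \sum_(j < 4) (x 0 i * y 0 j) *: S2_table i.+1 j.+1.

Fact S2_mul_is_bilinear : bilinear_for *:%R *:%R S2_mul.
Proof.
split=> [y a u v | x a u v]; rewrite /= /S2_mul scaler_sumr -big_split /=;
  apply: eq_bigr => i _; rewrite scaler_sumr -big_split /=;
  apply: eq_bigr => j _; rewrite !mxE scalerA -scalerDl.
  by rewrite mulrDl mulrA.
by rewrite mulrDr mulrCA.
Qed.

HB.instance Definition _ :=
  bilinear_isBilinear.Build K (S2 K) (S2 K) (S2 K) *:%R *:%R S2_mul
    S2_mul_is_bilinear.

Lemma S2_mul_basis (i j : 'I_4) :
  S2_mul (z i.+1) (z j.+1) = S2_table i.+1 j.+1.
Proof.
rewrite /S2_mul (bigD1 i) //= (bigD1 j) //= !mxE !eqxx mulr1 scale1r.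
rewrite !big1 ?addr0 // => k nk; last first.
  by rewrite !mxE eqSS (negbTE nk : (k == j :> nat) = false) mulr0 scale0r.
apply: big1 => l _.
by rewrite !mxE eqSS (negbTE nk : (k == i :> nat) = false) mul0r scale0r.
Qed.

End AlgebraS2.

(* Main.v *)
Require Import Defs.
From HB Require Import structures.
From mathcomp Require Import all_boot all_order all_algebra.
From mathcomp Require Import boolp classical_sets.
From mathcomp Require Import ring.
Import GRing.Theory.
Local Open Scope classical_set_scope.
Local Open Scope ring_scope.

(** Each partial map of a biderivation, one variable being fixed, is a linear
    derivation, so everything follows from the shape of the derivations of
    [S2 K].  Solving the Leibniz rule on the basis ([derivation_basis]) shows
    that a derivation [D] depends on two scalars [s] and [t]:
      [D z1 = -2s z2], [D z2 = -t z2 - 3s z3], [D z3 = -2t z3] and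
      [D z4 = s z1 + t z4].
    Three features of these formulas matter:
    - [D z1] and [D z2] lie in the span of [z2] and [z3], whereas [D z4] lies
      in the span of [z1] and [z4], and these two planes meet only in 0;
    - [D] is determined by [D z4] ([derivation_eq0_of_z4]);
    - if [D] kills [z1] and [z2], it kills [z4] ([derivation_z4_eq0]).

    For a biderivation [delta] and [i] in {1, 2}, the vector [delta z4 zi] is
    both the image of [zi] under the derivation [delta z4] and the image of
    [z4] under the derivation [delta ^~ zi]; it lies in both planes, hence
    vanishes.  The derivation [delta z4] therefore kills [z1] and [z2], then
    [z4], then everything.  Consequently each derivation [delta ^~ y] kills
    [z4], and so is zero ([biderivation_eq0]). *)

(** Explicit coordinates on [S2 K], on which the multiplication is a polynomial
    formula, so that the Leibniz rule becomes scalar equations. *)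
Definition vec4 {K : fieldType} (a b c d : K) : S2 K :=
  \row_(j < 4) [:: a; b; c; d]`_j.

Lemma vec4_eta (K : fieldType) (x : S2 K) :
  exists a b c d, x = vec4 a b c d.
Proof.
exists (x 0 (inord 0)), (x 0 (inord 1)), (x 0 (inord 2)), (x 0 (inord 3)).
apply/rowP => -[[|[|[|[|//]]]] j4]; rewrite !mxE /=;
  by congr (x 0 _); apply: val_inj; rewrite /= inordK.
Qed.

Lemma vec4_inj (K : fieldType) (a b c d a' b' c' d' : K) :
  vec4 a b c d = vec4 a' b' c' d' -> [/\ a = a', b = b', c = c' & d = d'].
Proof.
move=> /rowP eq_xy.
have := eq_xy (inord 0); have := eq_xy (inord 1).
have := eq_xy (inord 2); have := eq_xy (inord 3).
by rewrite !mxE !inordK.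
Qed.

Lemma vec4D (K : fieldType) (a b c d a' b' c' d' : K) :
  vec4 a b c d + vec4 a' b' c' d' = vec4 (a + a') (b + b') (c + c') (d + d').
Proof. by apply/rowP => -[[|[|[|[|//]]]] j4]; rewrite !mxE. Qed.

Lemma vec4Z (K : fieldType) (k a b c d : K) :
  k *: vec4 a b c d = vec4 (k * a) (k * b) (k * c) (k * d).
Proof. by apply/rowP => -[[|[|[|[|//]]]] j4]; rewrite !mxE. Qed.

Lemma vec4N (K : fieldType) (a b c d : K) :
  - vec4 a b c d = vec4 (- a) (- b) (- c) (- d).
Proof. by apply/rowP => -[[|[|[|[|//]]]] j4]; rewrite !mxE. Qed.

Lemma vec4_0 (K : fieldType) : (0 : S2 K) = vec4 0 0 0 0.
Proof. by apply/rowP => -[[|[|[|[|//]]]] j4]; rewrite !mxE. Qed.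

Lemma basis_vec4 (K : fieldType) :
  ((z K 1 = vec4 1 0 0 0) * (z K 2 = vec4 0 1 0 0)
   * (z K 3 = vec4 0 0 1 0) * (z K 4 = vec4 0 0 0 1))%type.
Proof. by do !split; apply/rowP => -[[|[|[|[|//]]]] j4]; rewrite !mxE. Qed.

Lemma vec4E (K : fieldType) (a b c d : K) :
  vec4 a b c d = a *: z K 1 + b *: z K 2 + c *: z K 3 + d *: z K 4.
Proof.
by rewrite !basis_vec4 !vec4Z !vec4D !(mulr0, mulr1, addr0, add0r).
Qed.

Lemma S2_mul_vec4 (K : fieldType) (a b c d a' b' c' d' : K) :
  S2_mul (vec4 a b c d) (vec4 a' b' c' d') =
  vec4 (- (a * a') + b * d' - 2%:R * (d * b'))
       (a * b' - 2%:R * (b * a') - d * c')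
       (3%:R * (a * c' - b * b'))
       (3%:R * (d * a' - a * d')).
Proof.
have sum4 (F : 'I_4 -> S2 K) :
    \sum_(i < 4) F i = F (inord 0) + F (inord 1) + F (inord 2) + F (inord 3).
  rewrite !big_ord_recl big_ord0 addr0 !addrA.
  by congr (F _ + F _ + F _ + F _); apply: val_inj; rewrite /= inordK.
rewrite /S2_mul !sum4 !mxE !inordK //= !basis_vec4 vec4_0.
rewrite !(vec4N, vec4Z, vec4D).
by congr vec4; ring.
Qed.

(** Half of the notion of a derivation: linearity is carried separately, by the
    type [{linear S2 K -> S2 K}]. *)
Definition leibniz {K : fieldType} (D : S2 K -> S2 K) : Prop :=
  forall x y, D (S2_mul x y) = S2_mul x (D y) + S2_mul (D x) y.

Lemma leibniz_table {K : fieldType} {D : S2 K -> S2 K} (leibD : leibniz D)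
    (i j : nat) : (0 < i <= 4)%N -> (0 < j <= 4)%N ->
  D (S2_table K i j) = S2_mul (z K i) (D (z K j)) + S2_mul (D (z K i)) (z K j).
Proof.
case: i j => [|i] [|j] //= i4 j4; rewrite -leibD.
by have /= -> := S2_mul_basis K (Ordinal i4) (Ordinal j4).
Qed.

(** Reduces an equation that follows linearly from a known one, [u = v], to an
    identity that [ring] can check. *)
Lemma eq_of_subr {V : zmodType} {x y u v : V} :
  u = v -> x - y = u - v -> x = y.
Proof. by move=> -> /eqP; rewrite subrr subr_eq0 => /eqP. Qed.

(** The derivations of [S2 K].  The Leibniz rule on the eight products
    [z1 z1], [z2 z1], [z2 z3], [z2 z4], [z3 z1], [z3 z4], [z4 z3], [z4 z4]
    suffices: each coordinate of the [D zi] other than [s] and [t] occurs with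
    coefficient 1 or -1 in one of the resulting equations, once like terms are
    collected, so [ring] can solve for it. *)
Lemma derivation_basis (K : fieldType) (D : {linear S2 K -> S2 K}) :
  leibniz D ->
  exists s t : K,
  [/\ D (z K 1) = vec4 0 (- (2%:R * s)) 0 0,
      D (z K 2) = vec4 0 (- t) (- (3%:R * s)) 0,
      D (z K 3) = vec4 0 0 (- (2%:R * t)) 0
    & D (z K 4) = vec4 s 0 0 t].
Proof.
move=> leibD.
have [a1 [b1 [c1 [d1 Dz1]]]] := vec4_eta K (D (z K 1)).
have [a2 [b2 [c2 [d2 Dz2]]]] := vec4_eta K (D (z K 2)).
have [a3 [b3 [c3 [d3 Dz3]]]] := vec4_eta K (D (z K 3)).
have [a4 [b4 [c4 [d4 Dz4]]]] := vec4_eta K (D (z K 4)).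
have lin := (linearN D, linearZ_LR D, linear0 D).
have Dz := (Dz1, Dz2, Dz3, Dz4).
have calc := (S2_mul_vec4 K, vec4N K, vec4Z K, vec4D K, vec4_0 K).
exists a4, d4; rewrite Dz1 Dz2 Dz3 Dz4.
(* Some table entries are opposites of multiples of basis vectors: [D] has to
   be moved through two operations, hence [lin] occurs twice. *)
have := leibniz_table leibD 1 1 isT isT.
rewrite /= ?lin ?lin !Dz !basis_vec4 !calc => /vec4_inj[z11_1 _ _ z11_4].
have := leibniz_table leibD 2 1 isT isT.
rewrite /= ?lin ?lin !Dz !basis_vec4 !calc => /vec4_inj[z21_1 _ _ _].
have := leibniz_table leibD 2 3 isT isT.
rewrite /= ?lin ?lin !Dz !basis_vec4 !calc => /vec4_inj[z23_1 z23_2 _ _].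
have := leibniz_table leibD 2 4 isT isT.
rewrite /= ?lin ?lin !Dz !basis_vec4 !calc => /vec4_inj[z24_1 z24_2 z24_3 _].
have := leibniz_table leibD 3 1 isT isT.
rewrite /= ?lin ?lin !Dz !basis_vec4 !calc => /vec4_inj[z31_1 _ _ _].
have := leibniz_table leibD 3 4 isT isT.
rewrite /= ?lin ?lin !Dz !basis_vec4 !calc => /vec4_inj[z34_1 _ _ _].
have := leibniz_table leibD 4 3 isT isT.
rewrite /= ?lin ?lin !Dz !basis_vec4 !calc => /vec4_inj[_ z43_2 z43_3 _].
have := leibniz_table leibD 4 4 isT isT.
rewrite /= ?lin ?lin !Dz !basis_vec4 !calc => /vec4_inj[z44_1 z44_2 _ _].
(* The order matters: later unknowns are solved in terms of earlier ones. *)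
have a1E : a1 = 0 by apply: (eq_of_subr z11_1); ring.
have d1E : d1 = 0 by apply: (eq_of_subr (esym z11_4)); ring.
have b4E : b4 = 0 by apply: (eq_of_subr z44_1); ring.
have c4E : c4 = 0 by apply: (eq_of_subr z44_2); ring.
have d3E : d3 = 0 by apply: (eq_of_subr (esym z23_1)); ring.
have a3E : a3 = 0 by apply: (eq_of_subr z31_1); ring.
have b3E : b3 = 0 by apply: (eq_of_subr (esym z34_1)); ring.
have b1E : b1 = - (2%:R * a4).
  by apply: (eq_of_subr z24_2); rewrite c4E; ring.
have c1E : c1 = 0 by apply: (eq_of_subr z24_3); rewrite b4E; ring.
have a2E : a2 = 0 by apply: (eq_of_subr (esym z21_1)); rewrite d1E; ring.
have d2E : d2 = 0 by apply: (eq_of_subr z23_2); rewrite a3E; ring.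
have b2E : b2 = - d4 by apply: (eq_of_subr (esym z24_1)); rewrite a1E; ring.
have c2E : c2 = - (3%:R * a4).
  by apply: (eq_of_subr (esym z43_3)); rewrite b4E; ring.
have c3E : c3 = - (2%:R * d4).
  by apply: (eq_of_subr z43_2); rewrite b2E; ring.
split; congr vec4; assumption.
Qed.

(** Both parameters of a derivation can be read off its value at [z4]. *)
Lemma derivation_eq0_of_z4 (K : fieldType) (D : {linear S2 K -> S2 K}) :
  leibniz D -> D (z K 4) = 0 -> forall x, D x = 0.
Proof.
move=> /derivation_basis[s [t [Dz1 Dz2 Dz3 Dz4]]].
rewrite Dz4 vec4_0 => /vec4_inj[s0 _ _ t0] x.
have [a [b [c [d ->]]]] := vec4_eta K x.
rewrite vec4E !linearD !linearZ_LR Dz1 Dz2 Dz3 Dz4 s0 t0 !mulr0 !oppr0.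
by rewrite -vec4_0 !scaler0 !addr0.
Qed.

(** From [D z1 = 0] and [D z2 = 0] one gets [t = 0], [2s = 0] and [3s = 0],
    whence [s = 3s - 2s = 0]. *)
Lemma derivation_z4_eq0 (K : fieldType) (D : {linear S2 K -> S2 K}) :
  leibniz D -> D (z K 1) = 0 -> D (z K 2) = 0 -> D (z K 4) = 0.
Proof.
move=> /derivation_basis[s [t [-> -> _ ->]]]; rewrite !vec4_0.
move=> /vec4_inj[_ s2 _ _] /vec4_inj[_ t0 s3 _].
congr vec4; last by apply: (eq_of_subr (esym t0)); ring.
by apply: (eq_of_subr (etrans s2 (esym s3))); ring.
Qed.

(** The argument plays the left and the right partial derivations of [delta]
    against each other, starting from the entries [delta z4 z1] and
    [delta z4 z2]. *)
Lemma biderivation_eq0 (K : fieldType) (delta : S2 K -> S2 K -> S2 K) :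
  is_biderivation (@S2_mul K) delta -> forall x y, delta x y = 0.
Proof.
move=> [[linl linr] leibl leibr].
pose l (y : S2 K) : {linear S2 K -> S2 K} :=
  HB.pack (delta ^~ y) (GRing.isLinear.Build K _ _ *:%R (delta ^~ y) (linl y)).
pose r (x : S2 K) : {linear S2 K -> S2 K} :=
  HB.pack (delta x) (GRing.isLinear.Build K _ _ *:%R (delta x) (linr x)).
have leib_l y : leibniz (l y) by move=> u v; exact: leibl.
have leib_r x : leibniz (r x) by move=> u v; exact: leibr.
have transverse (a b c d : K) x y :
    delta x y = vec4 0 a b 0 -> delta x y = vec4 c 0 0 d -> delta x y = 0.
  by move=> -> /vec4_inj[_ -> -> _]; rewrite -vec4_0.
have z4_l y : exists s t, delta (z K 4) y = vec4 s 0 0 t.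
  by have [s [t [_ _ _ ?]]] := derivation_basis K (l y) (leib_l y); exists s, t.
have [s [t [Dz1 Dz2 _ _]]] := derivation_basis K (r (z K 4)) (leib_r (z K 4)).
have z41 : delta (z K 4) (z K 1) = 0.
  by have [c [d z41_l]] := z4_l (z K 1); apply: transverse Dz1 z41_l.
have z42 : delta (z K 4) (z K 2) = 0.
  by have [c [d z42_l]] := z4_l (z K 2); apply: transverse Dz2 z42_l.
have z44 : delta (z K 4) (z K 4) = 0.
  exact: (derivation_z4_eq0 K (r (z K 4)) (leib_r _) z41 z42).
have z4_eq0 y : delta (z K 4) y = 0.
  exact: (derivation_eq0_of_z4 K (r (z K 4)) (leib_r _) z44).
by move=> x y; apply: (derivation_eq0_of_z4 K (l y) (leib_l y) (z4_eq0 y)).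
Qed.

Theorem theorem3p6 (K : fieldType) (charK : [pchar K] =i pred0) :
  (forall delta : S2 K -> S2 K -> S2 K,
     is_biderivation (@S2_mul K) delta <-> (forall x y : S2 K, delta x y = 0))
  /\ BDer (@S2_mul K) = [set (fun _ _ : S2 K => 0 : S2 K)].
Proof.
have bider0 (delta : S2 K -> S2 K -> S2 K) :
    is_biderivation (@S2_mul K) delta <-> (forall x y : S2 K, delta x y = 0).
  split=> [/biderivation_eq0 // | delta0].
  have mul0 x : S2_mul x 0 = 0 by rewrite linear0r.
  have mul0' x : S2_mul 0 x = 0 by rewrite linear0l.
  split=> [|x y t|x y t]; rewrite /= ?delta0 ?mul0 ?mul0' ?addr0 //.
  by split=> u a x y; rewrite /= !delta0 scaler0 addr0.
split=> //; apply/seteqP; split=> delta.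
  by move=> /bider0 delta0; apply/funext => x; apply/funext => y.
by move=> ->; apply/bider0.
Qed.
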